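(* Let $(G_n,d_n)$ be an admissible sequence of large essential girth such that $d_n\to\infty$ and $$t(K_2,G_n,d_n)=\frac{2\,\mathrm{e}(G_n)}{\mathrm{v}(G_n)d_n}\to t(K_2)$$ as $n\to\infty$, for some number $t(K_2)$. Let $\xi\in\mathbb{C}$ with $|\xi|\ge 8$. Then $$\frac{|\mathrm{ch}(G_n,\xi d_n)|^{1/\mathrm{v}(G_n)}}{|\xi|d_n}\to\exp\!\left(-t(K_2)\,\mathrm{Re}\,\frac{1}{2\xi}\right)\quad\text{as } n\to\infty.$$
   Context: Graphs are finite, simple and undirected; $\mathrm{v}(G)$ and $\mathrm{e}(G)$ are the numbers of nodes and edges; $K_2$ is the complete graph on two nodes and $C_k$ is the cycle on $k$ nodes. An admissible pair is a pair $(G,d)$ where $d\ge 1$ and $G$ is a graph with all degrees $\le d$; an admissible sequence is a sequence of admissible pairs. $\mathrm{inj}(F,G)$ is the number of injective homomorphisms from $F$ to $G$, and for a connected graph $F$ with at least two nodes, $t_{\mathrm{inj}}(F,G,d)=\mathrm{inj}(F,G)/\big(\mathrm{v}(G)\,d\,(d-1)^{\mathrm{v}(F)-2}\big)$. The admissible sequence $(G_n,d_n)$ has large essential girth if for every $k\ge 3$ we have $t_{\mathrm{inj}}(C_k,G_n,d_n)\to 0$ as $n\to\infty$. $\mathrm{ch}(G,x)$ is the chromatic polynomial of $G$: for integers $q\ge 0$, $\mathrm{ch}(G,q)$ is the number of proper $q$-colorings of $G$. *)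

(* Defs.v *)
From mathcomp Require Import all_boot all_order all_algebra.
From mathcomp Require Import all_classical all_reals all_analysis.
From mathcomp Require Import complex.
Import Order.TTheory GRing.Theory Num.Theory numFieldNormedType.Exports.

Set Implicit Arguments.
Unset Strict Implicit.
Unset Printing Implicit Defensive.

Local Open Scope ring_scope.

Record sgraph := SGraph {
  node :> finType;
  edge : rel node;
  edge_sym : symmetric edge;
  edge_irr : irreflexive edge
}.

Definition nv (G : sgraph) : nat := #|G|.

Definition edges (G : sgraph) : {set {set G}} :=
  [set A : {set G} | [exists x, exists y, edge x y && (A == [set x; y])]].

Definition ne (G : sgraph) : nat := #|edges G|.

Definition degree (G : sgraph) (x : G) : nat := #|[set y : G | edge x y]|.

(* The condition i != j only matters for k <= 2, where there is no cycle as a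
   simple graph. *)
Definition cycle_rel (k : nat) : rel 'I_k :=
  fun i j => (i != j) && ((ordS i == j) || (ordS j == i)).

Lemma cycle_rel_sym k : symmetric (@cycle_rel k).
Proof. by move=> i j; rewrite /cycle_rel eq_sym orbC. Qed.

Lemma cycle_rel_irr k : irreflexive (@cycle_rel k).
Proof. by move=> i; rewrite /cycle_rel eqxx. Qed.

Definition cycle_graph (k : nat) : sgraph :=
  SGraph (@cycle_rel_sym k) (@cycle_rel_irr k).

Definition is_hom (F G : sgraph) (f : F -> G) : bool :=
  [forall x, forall y, edge x y ==> edge (f x) (f y)].

Definition inj (F G : sgraph) : nat :=
  #|[set f : {ffun F -> G} | injectiveb f && is_hom f]|.

(* d is a real number: integrality is not part of admissibility. *)
Definition admissible (R : realType) (G : sgraph) (d : R) : Prop :=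
  1 <= d /\ forall x : G, (degree x)%:R <= d.

Definition t_inj (R : realType) (F G : sgraph) (d : R) : R :=
  (inj F G)%:R / ((nv G)%:R * d * (d - 1) ^+ (nv F - 2)).

Definition large_essential_girth (R : realType)
    (G : nat -> sgraph) (d : nat -> R) : Prop :=
  forall k : nat, (3 <= k)%N ->
    ((t_inj (cycle_graph k) (G n) (d n)) @[n --> \oo] --> (0 : R))%classic.

Definition is_coloring (G : sgraph) (q : nat) (f : G -> 'I_q) : bool :=
  [forall x, forall y, edge x y ==> (f x != f y)].

Definition ncolorings (G : sgraph) (q : nat) : nat :=
  #|[set f : {ffun G -> 'I_q} | is_coloring f]|.

Definition is_chrom_poly (G : sgraph) (p : {poly int}) : Prop :=
  forall q : nat, p.[q%:Z] = (ncolorings G q)%:Z.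

Section ChromPolyExists.
Variable G : sgraph.
Implicit Types J : {set G * G}.

Let adj J : rel G := fun x y => ((x, y) \in J) || ((y, x) \in J).

Let adj_csym J : connect_sym (adj J).
Proof. by apply: sym_connect_sym => x y; rewrite /adj orbC. Qed.

Let rt J : G -> G := fingraph.root (adj J).
Let crt J := {x : G | rt J x == x}.

Let card_mono J q :
  #|[set f : {ffun G -> 'I_q} | [forall p in J, f p.1 == f p.2]]|
  = (q ^ #|{: crt J}|)%N.
Proof.
have rtK x : rt J (rt J x) == rt J x by rewrite /rt root_root.
rewrite -[q in RHS]card_ord -card_ffun.
pose h (g : {ffun crt J -> 'I_q}) : {ffun G -> 'I_q} :=
  [ffun x => g (exist _ (rt J x) (rtK x))].
have h_inj : injective h.
  move=> g1 g2 e12; apply/ffunP => -[x xP].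
  move/ffunP: e12 => /(_ x); rewrite !ffunE.
  suff -> : exist _ (rt J x) (rtK x) = exist _ x xP :> crt J by [].
  by apply: val_inj => /=; apply/eqP.
rewrite -(card_imset _ h_inj); apply: eq_card => f; rewrite inE.
apply/forallP/imsetP => [fJ | [g _ ->] p].
- exists [ffun u : crt J => f (val u)] => //.
  apply/ffunP => x; rewrite !ffunE /=.
  have conn s : forall u, path (adj J) u s -> f u = f (last u s).
    elim: s => //= v s IH u /andP [uv vs]; rewrite -(IH v vs).
    by case/orP: uv => /(implyP (fJ _)) /= /eqP.
  have /connectP [s xs ->] : connect (adj J) x (rt J x) by exact: connect_root.
  exact: conn.
- apply/implyP => pJ; rewrite !ffunE; apply/eqP; congr (g _); apply: val_inj.
  apply/eqP; rewrite /= /rt root_connect //; apply: connect1.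
  by rewrite /adj -surjective_pairing pJ.
Qed.

Lemma chrom_poly_exists : exists p : {poly int}, is_chrom_poly G p.
Proof.
pose E : {set G * G} := [set p | edge p.1 p.2].
exists (\sum_(J : {set G * G} | J \subset E)
          (-1) ^+ #|J| *: 'X^#|{: crt J}|) => q.
have bad (f : {ffun G -> 'I_q}) : ((is_coloring f : nat)%:Z) =
    \sum_(J : {set G * G} | J \subset E)
      (-1) ^+ #|J| * ([forall p in J, f p.1 == f p.2] : nat)%:Z.
  pose a (p : G * G) : int := - ((edge p.1 p.2 && (f p.1 == f p.2)) : nat)%:Z.
  transitivity (\prod_p (a p + 1)).
    case: (boolP (is_coloring f)) => [|/forallPn [x /forallPn [y]]].
      move/forallP => fc; rewrite big1 // => -[x y] _.
      have /forallP/(_ y) := fc x; rewrite /a /=.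
      by case: (edge x y) => //= /negbTE ->.
    rewrite negb_imply negbK => xy.
    by rewrite (bigD1 (x, y)) //= /a /= xy addNr mul0r.
  rewrite bigA_distr /=.
  rewrite (bigID (fun J : {set G * G} => J \subset E)) /= [X in _ + X]big1.
    rewrite addr0; apply: eq_bigr => J JE.
    rewrite -big_mkcond /=.
    have [/forallP fJ | ] := boolP [forall p in J, f p.1 == f p.2].
      rewrite mulr1 -prodr_const; apply: eq_bigr => p pJ.
      rewrite /a; have /implyP/(_ pJ) -> := fJ p.
      by have := fintype.subsetP JE _ pJ; rewrite inE => ->.
    case/forallPn => p; rewrite negb_imply => /andP [pJ /negbTE fp].
    by rewrite (bigD1 p) //= /a fp andbF oppr0 mul0r mulr0.
  move=> J /subsetPn [p pJ]; rewrite inE => /negbTE pE.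
  by rewrite (bigD1 p) //= pJ /a pE oppr0 mul0r.
have countE (P : pred {ffun G -> 'I_q}) :
    (#|[set f | P f]|)%:Z = \sum_f ((P f : nat)%:Z).
  rewrite -sum1_card big_mkcond /= -natz natr_sum.
  by apply: eq_bigr => f _; rewrite natz inE; case: (P f).
rewrite horner_sum /ncolorings countE.
under [RHS]eq_bigr do rewrite bad.
rewrite exchange_big /=; apply: eq_bigr => J _.
rewrite -mulr_sumr hornerZ hornerXn -countE card_mono; congr (_ * _).
by rewrite -!natz natrX.
Qed.

End ChromPolyExists.

Lemma is_chrom_poly_uniq (G : sgraph) (p1 p2 : {poly int}) :
  is_chrom_poly G p1 -> is_chrom_poly G p2 -> p1 = p2.
Proof.
move=> h1 h2; apply/eqP; rewrite -subr_eq0; apply/negPn/negP => p0.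
pose s : seq int := [seq i%:Z | i <- iota 0 (size (p1 - p2))].
suff : (size s < size (p1 - p2)%R)%N by rewrite size_map size_iota ltnn.
apply: max_poly_roots => //.
  by apply/allP => _ /mapP [i _ ->]; rewrite /root !hornerE h1 h2 subrr.
by rewrite map_inj_uniq ?iota_uniq // => i j [].
Qed.

Definition chrom_poly (G : sgraph) : {poly int} :=
  sval (cid (chrom_poly_exists G)).

Lemma chrom_polyP (G : sgraph) : is_chrom_poly G (chrom_poly G).
Proof. exact: svalP. Qed.

Definition ch (R : realType) (G : sgraph) (x : R[i]) : R[i] :=
  (map_poly intr (chrom_poly G)).[x].

(* Modulus as an element of R; the norm `|z| of the library lives in R[i]. *)
Definition cmod (R : realType) (z : R[i]) : R := ComplexField.Normc.normc z.

(* Main.v *)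
Require Import Defs.
From mathcomp Require Import all_boot all_order all_algebra.
From mathcomp Require Import all_classical all_reals all_analysis.
From mathcomp Require Import complex.
From mathcomp Require Import ring lra.
From mathcomp Require Import fintype finset perm.
Import Order.TTheory GRing.Theory Num.Theory numFieldNormedType.Exports.
Set Implicit Arguments.
Unset Strict Implicit.
Unset Printing Implicit Defensive.
Local Open Scope ring_scope.

(** Write v for the number of nodes of G, x = 1/z and y = |x|, where z = xi d.
    For a set W of nodes and a subset B of W let phi W B be z^-|W| times the
    value at z of the polynomial counting the proper colourings of G[W] in
    which no node of B has colour 0; then ch(G, z) = z^v phi V 0, where V is
    the set of all nodes and 0 the empty set. Two identities hold for counts,
    hence for polynomials.
    - Peeling ([phi_peel]): for b in B, separating the colourings that give b
      colour 0 yields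
        phi W B = phi W (B - b) - x phi (W - b) ((B - b) + N(b)).
    - Rooting ([phi_root]): by symmetry of the colours,
        phi W 0 = phi (W - u) (N(u)).

    Zero-freeness. Put beta = 1 + 2 y. Induction along peeling gives
      |phi W B - phi W 0| <= (beta^|B| - 1) |phi W 0|        ([phi_near]).
    For B = N(u) this and rooting show that adding a node multiplies |phi W 0|
    by at least 1 - (beta^d - 1) >= 2/3, since y d <= 1/8 gives
    beta^d <= 4/3. The peeled term then costs at most
    y (4/3) (3/2) = 2 y = beta - 1 times beta^(|B| - 1), which closes the
    induction.

    Effect of cycles. If no cycle passed through u, the neighbours of u would
    lie in different components of W - u, and rooting would give
    phi W 0 = (1 - x)^deg(u) phi (W - u) 0. In general, peeling N(u) compares
    phi W D with the value obtained when a further node b is given colour 0;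
    following both through the same peelings, the difference survives only
    along self-avoiding paths from D to b, a path with m edges having weight
    at most (2 y)^m ([phi_pin]). So the relative error at u is a weighted
    count of cycles through u ([phi_forest]). Taking logarithms and summing
    over an elimination order of the nodes,
      | ln |phi V 0| - e(G) ln |1 - x| | <= sum_m (2 y)^(m + 1) C_m,
    where C_m counts rooted oriented cycles of length m + 2 ([ln_phi],
    [forks_cycles]).

    Limit. As 2 y d <= 1/4, the bound C_m <= v d^(m + 1) dominates the m-th
    term, divided by v, by 4^-(m + 1), while large essential girth sends each
    term to 0 because C_m <= inj(C_(m + 2), G); hence the error is o(v)
    ([tannery0]). What remains is
    (e/v) ln |1 - 1/(xi d)| = (2 e/(v d)) (d ln |1 - 1/(xi d)|)/2, which tends
    to - t(K_2) Re (1/xi)/2 ([cvg_edge_factor]). *)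

(** * Neighbourhoods and induced edges *)

Section Neighbours.
Variable G : sgraph.
Implicit Types (W : {set G}) (u b : G).

Definition nbrs W b : {set G} := [set y in W | edge b y].

Lemma in_nbrs W b y : (y \in nbrs W b) = (y \in W) && edge b y.
Proof. by rewrite inE. Qed.

Lemma card_nbrs W b : (#|nbrs W b| <= degree b)%N.
Proof.
by apply: subset_leq_card; apply/fintype.subsetP => w; rewrite !inE => /andP[].
Qed.

Lemma nbrs_sub W b : nbrs W b \subset W :\ b.
Proof.
apply/fintype.subsetP => w; rewrite !inE => /andP[-> bw]; rewrite andbT.
by apply: contraTneq bw => ->; rewrite edge_irr.
Qed.

Lemma nbrs_mono W W' u : W \subset W' -> nbrs W u \subset nbrs W' u.
Proof.
move=> S; apply/fintype.subsetP => w; rewrite !in_nbrs => /andP[wW ->].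
by rewrite (fintype.subsetP S).
Qed.

Definition edges_in W : {set {set G}} := [set A in edges G | A \subset W].

Lemma edges_in_root W u : u \in W ->
  #|edges_in W| = (#|edges_in (W :\ u)| + #|nbrs W u|)%N.
Proof.
move=> uW; rewrite -(cardsID [set A : {set G} | u \notin A] (edges_in W)).
congr (_ + _)%N.
  apply: eq_card => A; by rewrite !inE subsetD1 andbA.
have inj2 : {in nbrs W u &, injective (fun w => [set u; w])}.
  move=> v w; rewrite !in_nbrs => /andP[_ uv] /andP[_ uw] /setP/(_ v).
  rewrite !inE eqxx orbT => /esym/orP[/eqP vu|/eqP //].
  by move: uv; rewrite vu edge_irr.
rewrite -(card_in_imset inj2); apply: eq_card => A; rewrite !inE negbK.
apply/idP/imsetP => [/and3P[uA /existsP[v /existsP[w /andP[vw /eqP AE]]] AW]|].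
  move: uA AW; rewrite AE !inE => /orP[]/eqP e AW; subst u.
    exists w => //; rewrite in_nbrs vw andbT.
    by apply: (fintype.subsetP AW); rewrite !inE eqxx orbT.
  exists v; last by rewrite setUC.
  rewrite in_nbrs edge_sym vw andbT.
  by apply: (fintype.subsetP AW); rewrite !inE eqxx.
case=> w; rewrite in_nbrs => /andP[wW uw] ->.
rewrite !inE eqxx /=; apply/andP; split.
  by apply/existsP; exists u; apply/existsP; exists w; rewrite uw eqxx.
by rewrite subUset !sub1set uW wW.
Qed.

Lemma edges_inT : #|edges_in [set: G]| = ne G.
Proof. by apply: eq_card => A; rewrite !inE subsetT andbT. Qed.

End Neighbours.

(** * Colourings avoiding one colour on a set *)

Section RootedColorings.
Variable G : sgraph.
Implicit Types (W B : {set G}) (u b : G).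

(** Colour [ord0] is the avoided one, so there are [q.+1] colours. Nodes
    outside [W] are pinned to [ord0] rather than left out: a colouring that
    gives [b] colour [ord0] is then literally a colouring for [W :\ b], and
    peeling becomes a partition of sets of functions. *)
Definition rcolorings q W B : {set {ffun G -> 'I_q.+1}} :=
  [set f : {ffun G -> 'I_q.+1} | [&& [forall y, (y \notin W) ==> (f y == ord0)],
               [forall a, forall y, [&& a \in W, y \in W & edge a y] ==> (f a != f y)]
             & [forall b in B, f b != ord0]]].

Lemma rcoloringsP q W B (f : {ffun G -> 'I_q.+1}) :
  reflect [/\ forall y, y \notin W -> f y = ord0,
              forall a y, a \in W -> y \in W -> edge a y -> f a != f y
            & forall b, b \in B -> f b != ord0]
          (f \in rcolorings q W B).
Proof.
rewrite inE; apply: (iffP and3P) => -[h1 h2 h3]; split.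
- by move=> y yW; apply/eqP; move/forallP: h1 => /(_ y) /implyP; apply.
- move=> a y aW yW ay; move/forallP: h2 => /(_ a) /forallP/(_ y) /implyP.
  by apply; rewrite aW yW.
- by move=> b bB; move/forallP: h3 => /(_ b) /implyP; apply.
- by apply/forallP => y; apply/implyP => /h1 ->.
- by apply/forallP => a; apply/forallP => y; apply/implyP => /and3P[]; exact: h2.
- by apply/forallP => b; apply/implyP; exact: h3.
Qed.

(** The colourings for [B :\ b] split according to whether [b] has colour
    [ord0]; if it has, its neighbours must avoid [ord0]. *)
Lemma card_rcolorings_peel q W B b : b \in B -> b \in W ->
  #|rcolorings q W (B :\ b)| =
  (#|rcolorings q W B| + #|rcolorings q (W :\ b) (B :\ b :|: nbrs W b)|)%N.
Proof.
move=> bB bW.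
rewrite -(cardsID [set f : {ffun G -> 'I_q.+1} | f b != ord0]); congr (_ + _)%N.
  apply: eq_card => f; rewrite in_setI [in X in _ && X]inE.
  apply/andP/idP => [[/rcoloringsP[h1 h2 h3] fb]|/rcoloringsP[h1 h2 h3]].
    apply/rcoloringsP; split=> // c cB; have [-> //|cb] := eqVneq c b.
    by apply: h3; rewrite !inE cb.
  split; last exact: h3.
  by apply/rcoloringsP; split=> // c /setD1P[_]; exact: h3.
apply: eq_card => f; rewrite in_setD inE negbK.
apply/andP/idP => [[/eqP fb /rcoloringsP[h1 h2 h3]]|/rcoloringsP[h1 h2 h3]].
  apply/rcoloringsP; split.
  - by move=> y; rewrite !inE negb_and negbK => /orP[/eqP-> //|]; exact: h1.
  - by move=> a y /setD1P[_ aW] /setD1P[_ yW]; exact: h2.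
  - move=> c /setUP[|]; first exact: h3.
    by rewrite in_nbrs => /andP[cW bc]; rewrite -fb eq_sym h2.
have fb : f b = ord0 by apply: h1; rewrite !inE eqxx.
split; first exact/eqP.
apply/rcoloringsP; split.
- by move=> y yW; apply: h1; rewrite !inE negb_and yW orbT.
- move=> a y aW yW ay.
  have [ab|ab] := eqVneq a b.
    by rewrite ab fb eq_sym h3 // !inE yW -ab ay orbT.
  have [yb|yb] := eqVneq y b; last by apply: h2; rewrite // !inE ?ab ?yb.
  by rewrite yb fb h3 // !inE aW edge_sym -yb ay orbT.
- by move=> c cB; apply: h3; rewrite inE cB.
Qed.

(** Exchanging [ord0] with another colour shows that each colour of [u] is
    taken by equally many colourings. *)
Lemma card_rcolorings_root q W u : u \in W ->
  #|rcolorings q W set0| = (q.+1 * #|rcolorings q (W :\ u) (nbrs W u)|)%N.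
Proof.
move=> uW.
pose T (c : 'I_q.+1) := [set f in rcolorings q W set0 | f u == c].
have TE : #|rcolorings q W set0| = (\sum_(c : 'I_q.+1) #|T c|)%N.
  rewrite -sum1_card (partition_big (fun f : {ffun G -> 'I_q.+1} => f u) predT) //=.
  by apply: eq_bigr => c _; rewrite -sum1_card; apply: eq_bigl => f; rewrite !inE.
(* The exchange acts on W only, as nodes outside W must keep ord0. *)
pose h (c : 'I_q.+1) (f : {ffun G -> 'I_q.+1}) :=
  [ffun y => if y \in W then tperm ord0 c (f y) else ord0] : {ffun G -> 'I_q.+1}.
have hT f c c' : f \in T c' -> h c f \in T (tperm ord0 c c').
  rewrite [in X in X -> _]inE => /andP[/rcoloringsP[h1 h2 _] /eqP fu].
  rewrite inE ffunE uW fu eqxx andbT; apply/rcoloringsP; split.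
  - by move=> y yW; rewrite ffunE (negbTE yW).
  - by move=> a y aW yW ay; rewrite !ffunE aW yW (inj_eq perm_inj) h2.
  - by move=> ?; rewrite inE.
have hK c c' f : f \in T c' -> h c (h c f) = f.
  rewrite inE => /andP[/rcoloringsP[h1 _ _] _].
  apply/ffunP => y; rewrite !ffunE; have [yW|yW] := boolP (y \in W).
    by rewrite tpermK.
  by rewrite h1.
have cT c : #|T c| = #|T ord0|.
  have le1 a : (#|T a| <= #|T (tperm ord0 c a)|)%N.
    rewrite -(@card_in_imset _ _ (h c) (T a)); last first.
      by move=> f g fT gT e; rewrite -(hK c a f fT) -(hK c a g gT) e.
    by apply: subset_leq_card; apply/fintype.subsetP => _ /imsetP[f fT ->]; exact: hT.
  apply/eqP; rewrite eqn_leq; have := le1 c; rewrite tpermR => ->.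
  by have := le1 ord0; rewrite tpermL => ->.
have T0 : T ord0 = rcolorings q (W :\ u) (nbrs W u).
  apply/setP => f; rewrite inE; apply/andP/idP.
    move=> [/rcoloringsP[h1 h2 _] /eqP fu]; apply/rcoloringsP; split.
    - by move=> y; rewrite !inE negb_and negbK => /orP[/eqP->//|]; exact: h1.
    - by move=> a y /setD1P[_ aW] /setD1P[_ yW]; exact: h2.
    - by move=> y; rewrite in_nbrs -fu eq_sym => /andP[yW uy]; exact: h2.
  move=> /rcoloringsP[h1 h2 h3].
  have fu : f u = ord0 by apply: h1; rewrite !inE eqxx.
  split; last exact/eqP.
  apply/rcoloringsP; split.
  - by move=> y yW; apply: h1; rewrite !inE negb_and yW orbT.
  - move=> a y aW yW ay.
    have [ab|ab] := eqVneq a u.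
      by rewrite ab fu eq_sym h3 // in_nbrs yW -ab ay.
    have [yb|yb] := eqVneq y u; last by apply: h2; rewrite // !inE ?ab ?yb.
    by rewrite yb fu h3 // in_nbrs aW edge_sym -yb ay.
  - by move=> ?; rewrite inE.
rewrite TE (eq_bigr (fun _ => #|rcolorings q (W :\ u) (nbrs W u)|)).
  by rewrite sum_nat_const card_ord.
by move=> c _; rewrite cT T0.
Qed.

Lemma card_rcolorings_set0 q : #|rcolorings q set0 set0| = 1%N.
Proof.
apply/eqP/cards1P; exists [ffun=> ord0]; apply/setP => f; rewrite in_set1.
apply/rcoloringsP/eqP => [[h1 _ _]|->].
  by apply/ffunP => y; rewrite ffunE h1 ?inE.
by split=> [y _|a y|b]; rewrite ?ffunE ?inE.
Qed.

Lemma card_rcolorings_setT q : #|rcolorings q [set: G] set0| = ncolorings G q.+1.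
Proof.
apply: eq_card => f; rewrite [in RHS]inE.
apply/rcoloringsP/forallP => [[_ h _] a|h].
  by apply/forallP => y; apply/implyP => ay; apply: h; rewrite ?inE.
split=> [y|a y _ _ ay|b]; rewrite ?inE //.
by have /forallP/(_ y)/implyP := h a; apply.
Qed.

Lemma poly_eq_succ (p r : {poly int}) :
  (forall q : nat, p.[q.+1%:Z] = r.[q.+1%:Z]) -> p = r.
Proof.
move=> h; apply/eqP; rewrite -subr_eq0; apply/negPn/negP => p0.
pose s : seq int := [seq i.+1%:Z | i <- iota 0 (size (p - r))].
suff : (size s < size (p - r)%R)%N by rewrite size_map size_iota ltnn.
apply: max_poly_roots => //.
  by apply/allP => _ /mapP [i _ ->]; rewrite /root !hornerE h subrr.
by rewrite map_inj_uniq ?iota_uniq // => i j [].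
Qed.

(** Peeling empties [B] and rooting then shrinks [W], so the two identities
    compute a polynomial; conversely, agreement at all positive integers
    lifts both identities to the polynomials. *)
Lemma rcolorings_poly_exists W B : exists p : {poly int},
  forall q, p.[q.+1%:Z] = #|rcolorings q W B|%:Z.
Proof.
have [n] := ubnP #|W|; elim: n W B => // n IHn W B; rewrite ltnS => Wn.
have [m] := ubnP #|B|; elim: m B => // m IHm B; rewrite ltnS => Bm.
have [->|[b bB]] := set_0Vmem B.
  have [->|[u uW]] := set_0Vmem W.
    by exists 1 => q; rewrite hornerC card_rcolorings_set0.
  have [|p hp] := IHn (W :\ u) (nbrs W u).
    by move: Wn; rewrite (cardsD1 u) uW.
  by exists ('X * p) => q; rewrite hornerM hornerX hp (card_rcolorings_root _ uW) PoszM.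
(* A node of B outside W is pinned to the colour that it must avoid. *)
have [bW|bW] := boolP (b \in W); last first.
  exists 0 => q; rewrite horner0 (_ : rcolorings _ _ _ = set0) ?cards0 //.
  apply/setP => f; rewrite in_set0; apply/negP => /rcoloringsP[h1 _ h3].
  by have := h3 b bB; rewrite h1 // eqxx.
have [|p hp] := IHm (B :\ b); first by move: Bm; rewrite (cardsD1 b B) bB.
have [|r hr] := IHn (W :\ b) (B :\ b :|: nbrs W b).
  by move: Wn; rewrite (cardsD1 b W) bW.
exists (p - r) => q.
by rewrite hornerD hornerN hp hr (card_rcolorings_peel _ bB bW) PoszD addrK.
Qed.

Definition rpoly W B : {poly int} := sval (cid (rcolorings_poly_exists W B)).

Lemma rpolyE W B q : (rpoly W B).[q.+1%:Z] = #|rcolorings q W B|%:Z.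
Proof. exact: (svalP (cid (rcolorings_poly_exists W B))). Qed.

Lemma rpoly_peel W B b : b \in B -> b \in W ->
  rpoly W B = rpoly W (B :\ b) - rpoly (W :\ b) (B :\ b :|: nbrs W b).
Proof.
move=> bB bW; apply: poly_eq_succ => q.
by rewrite hornerD hornerN !rpolyE (card_rcolorings_peel _ bB bW) PoszD addrK.
Qed.

Lemma rpoly_root W u : u \in W ->
  rpoly W set0 = 'X * rpoly (W :\ u) (nbrs W u).
Proof.
move=> uW; apply: poly_eq_succ => q.
by rewrite hornerM hornerX !rpolyE (card_rcolorings_root _ uW) PoszM.
Qed.

Lemma rpoly_set0 : rpoly set0 set0 = 1.
Proof.
by apply: poly_eq_succ => q; rewrite rpolyE card_rcolorings_set0 hornerC.
Qed.

Lemma rpoly_setT : rpoly [set: G] set0 = chrom_poly G.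
Proof.
by apply: poly_eq_succ => q; rewrite rpolyE card_rcolorings_setT chrom_polyP.
Qed.

End RootedColorings.

(** * The modulus of a complex number *)

Section Modulus.
Variable R : realType.
Implicit Types z w : R[i].

Lemma cmodM z w : cmod (z * w) = cmod z * cmod w.
Proof. exact: ComplexField.Normc.normcM. Qed.

Lemma cmodV z : cmod z^-1 = (cmod z)^-1.
Proof. exact: ComplexField.Normc.normcV. Qed.

Lemma cmod1 : cmod (1 : R[i]) = 1.
Proof. exact: ComplexField.Normc.normc1. Qed.

Lemma cmod0 : cmod (0 : R[i]) = 0.
Proof. exact: ComplexField.Normc.normc0. Qed.

Lemma cmodX z n : cmod (z ^+ n) = cmod z ^+ n.
Proof. by elim: n => [|n IHn]; rewrite ?cmod1 // !exprS cmodM IHn. Qed.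

Lemma cmodN z : cmod (- z) = cmod z.
Proof. exact: normcN. Qed.

Lemma cmod_ge0 z : 0 <= cmod z.
Proof. by case: z => a b; exact: sqrtr_ge0. Qed.

Lemma cmod_eq0 z : (cmod z == 0) = (z == 0).
Proof.
by apply/eqP/eqP => [/ComplexField.Normc.eq0_normc //|->]; rewrite cmod0.
Qed.

Lemma cmodD z w : cmod (z + w) <= cmod z + cmod w.
Proof. exact: le_normcD. Qed.

Lemma cmodB z w : cmod (z - w) <= cmod z + cmod w.
Proof. by rewrite -(cmodN w); exact: cmodD. Qed.

Lemma cmod_subC z w : cmod (z - w) = cmod (w - z).
Proof. by rewrite -cmodN opprB. Qed.

(** The form in which the triangle inequality transports a bound from [w] to
    a nearby [z]. *)
Lemma cmod_le_dist z w : cmod z <= cmod w + cmod (z - w).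
Proof. by rewrite -{1}(subrK w z) addrC; exact: cmodD. Qed.

Lemma cmod_real (a : R) : 0 <= a -> cmod (real_complex R a) = a.
Proof.
by move=> a0; rewrite /cmod/= expr0n/= addr0 sqrtr_sqr ger0_norm.
Qed.

Lemma cmod_sqr_1B (w : R[i]) :
  cmod (1 - w) ^+ 2 = 1 - 2 * complex.Re w + cmod w ^+ 2.
Proof.
case: w => a b; rewrite /cmod /= !sqr_sqrtr ?addr_ge0 ?sqr_ge0 //.
by rewrite sub0r; ring.
Qed.

Lemma Re_mul_real (w : R[i]) (a : R) :
  complex.Re (w * real_complex R a) = complex.Re w * a.
Proof. by case: w => s t /=; rewrite mulr0 subr0. Qed.

End Modulus.

(** * Elementary real estimates *)

Section RealEstimates.
Variable R : realType.

(** Indeed [(1 + k) ^+ n * (1 - n * k) <= 1], and [1 - n * k >= 3 / 4]. *)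
Lemma expr_1D_bound (k : R) n : 0 <= k -> n%:R * k <= 4^-1 ->
  (1 + k) ^+ n <= 4 / 3.
Proof.
move=> k0 nk.
suff h : (1 + k) ^+ n * (1 - n%:R * k) <= 1.
  have a0 : 0 <= (1 + k) ^+ n by apply: exprn_ge0; lra.
  move: h a0 nk; set a := (1 + k) ^+ n; set c := n%:R * k => h a0 nk.
  have : 0 <= a * (4^-1 - c) by rewrite mulr_ge0 // subr_ge0.
  lra.
elim: n nk => [|n IHn]; first by rewrite expr0; lra.
rewrite -addn1 natrD => nk.
have nn : 0 <= n%:R :> R by [].
apply: le_trans (IHn _); last nra.
rewrite addn1 exprSr -mulrA; apply: ler_wpM2l; first by apply: exprn_ge0; lra.
nra.
Qed.

Lemma ln_dist (m X Y : R) : 0 < m -> m <= X -> m <= Y ->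
  `|ln X - ln Y| <= `|X - Y| / m.
Proof.
move=> m0.
have half (U V : R) : m <= U -> m <= V -> ln U - ln V <= `|U - V| / m.
  move=> mU mV; have U0 : 0 < U by exact: lt_le_trans mU.
  have V0 : 0 < V by exact: lt_le_trans mV.
  rewrite -ln_div ?posrE //.
  have -> : U / V = 1 + (U - V) / V by field; rewrite gt_eqF.
  apply: (@le_trans _ _ ((U - V) / V)).
    apply: le_ln1Dx; rewrite mulrBl divff ?gt_eqF //.
    by have := divr_gt0 U0 V0; lra.
  apply: (@le_trans _ _ (`|U - V| / V)).
    by rewrite ler_wpM2r ?invr_ge0 ?ler_norm // ltW.
  by rewrite ler_wpM2l // lef_pV2 // posrE.
move=> mX mY; rewrite ler_norml half // andbT lerNl opprB.
by rewrite distrC half.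
Qed.

Lemma ln1D_ge (w : R) : -1 < w -> w / (1 + w) <= ln (1 + w).
Proof.
move=> w1; have w0 : 0 < 1 + w by lra.
have e : 1 + - (w / (1 + w)) = (1 + w)^-1 by field; rewrite gt_eqF.
have : ln (1 + - (w / (1 + w))) <= - (w / (1 + w)).
  apply: le_ln1Dx; rewrite -subr_gt0 opprK addrC e; by rewrite invr_gt0.
by rewrite e lnV ?posrE // lerN2.
Qed.

Lemma geometric_tail M N :
  \sum_(M <= m < N) (4^-1 : R) ^+ m <= 4 / 3 * 4^-1 ^+ M.
Proof.
have e0 n : 0 <= (4^-1 : R) ^+ n by rewrite exprn_ge0.
have [MN|NM] := leqP M N; last by rewrite big_geq 1?ltnW // mulr_ge0.
suff -> : \sum_(M <= m < N) (4^-1 : R) ^+ m = 4 / 3 * (4^-1 ^+ M - 4^-1 ^+ N).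
  by have := e0 N; lra.
elim: N MN => [|N IHN]; first by rewrite leqn0 => /eqP->; rewrite big_geq // subrr mulr0.
rewrite leq_eqVlt => /orP[/eqP->|MN]; first by rewrite big_geq // subrr mulr0.
by rewrite big_nat_recr //= IHN // exprS; lra.
Qed.

(** Dominated convergence for sums whose length varies with [n]: beyond a
    fixed rank the terms are negligible uniformly in [n], and before it there
    are finitely many of them. *)
Lemma tannery0 (c : nat -> nat -> R) (N : nat -> nat) :
  (forall n m, 0 <= c n m <= 4^-1 ^+ m) ->
  (forall m, (c n m @[n --> \oo] --> (0 : R))%classic) ->
  (\sum_(m < N n) c n m @[n --> \oo] --> (0 : R))%classic.
Proof.
move=> c01 c0; apply/cvgr0Pnorm_lt => e e0.
have [M hM] : exists M, 4 / 3 * 4^-1 ^+ M < e / 2.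
  have : ((4 / 3 * 4^-1 ^+ M : R) @[M --> \oo] --> (0 : R))%classic.
    by apply: cvg_geometric; rewrite ger0_norm; lra.
  move=> /cvgr0Pnorm_lt /(_ (e / 2) ltac:(by rewrite divr_gt0)) [M _ hM].
  exists M; apply: le_lt_trans (hM M _); last exact: leqnn.
  exact: ler_norm.
have sM : (\sum_(m < M) c n m @[n --> \oo] --> (0 : R))%classic.
  elim: M {hM} => [|M IHM].
    by under eq_fun do rewrite big_ord0; exact: cvg_cst.
  under eq_fun do rewrite big_ord_recr /=.
  have h : (\sum_(m < M) c n m + c n M @[n --> \oo] --> (0 + 0 : R))%classic.
    exact: cvgD.
  by rewrite addr0 in h.
move: sM => /cvgr0Pnorm_lt /(_ (e / 2) ltac:(by rewrite divr_gt0)).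
apply: filterS => n hn.
have s0 P : 0 <= \sum_(m < P) c n m.
  by apply: sumr_ge0 => m _; case/andP: (c01 n m).
rewrite ger0_norm //; rewrite ger0_norm // in hn.
apply: (@le_lt_trans _ _ (\sum_(m < M) c n m + 4 / 3 * 4^-1 ^+ M)); last lra.
rewrite -!(big_mkord xpredT (c n)).
have [MN|NM] := leqP M (N n).
  rewrite (big_cat_nat (leq0n _) MN) /= lerD2l.
  apply: le_trans (geometric_tail M (N n)).
  by apply: ler_sum => m _; case/andP: (c01 n m).
rewrite [in leRHS](big_cat_nat (leq0n _) (ltnW NM)) /= -addrA lerDl addr_ge0 //.
  by apply: sumr_ge0 => m _; case/andP: (c01 n m).
Qed.

End RealEstimates.

(** * Self-avoiding paths and cycles *)

Section CycleCount.
Variable G : sgraph.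
Implicit Types (W : {set G}) (a b u : G).

(** Number of self-avoiding paths with [m] edges from [a] to [b] all of whose
    nodes except possibly [a] lie in [W]; deleting the current node from [W]
    makes them self-avoiding. The recursion mirrors the way peeling moves
    from [a] to its neighbours. *)
Fixpoint npaths m W a b : nat :=
  if m is m'.+1 then (\sum_(c in nbrs (W :\ a) a) npaths m' (W :\ a) c b)%N
  else (a == b).

Lemma npathsS m W a b :
  npaths m.+1 W a b = (\sum_(c in nbrs (W :\ a) a) npaths m (W :\ a) c b)%N.
Proof. by []. Qed.

Lemma npaths_mono m W W' a b : W \subset W' -> (npaths m W a b <= npaths m W' a b)%N.
Proof.
elim: m W W' a => // m IHm W W' a WW'; rewrite !npathsS.
have S : W :\ a \subset W' :\ a by exact: setSD.
rewrite big_mkcond [leqRHS]big_mkcond leq_sum //= => c _.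
rewrite !in_nbrs; case: ifP => // /andP[cW ->].
by rewrite (fintype.subsetP S) //= IHm.
Qed.

(** Cycles of length [m + 2] with a root [u] and an orientation: a path
    with [m] edges between two neighbours of [u] that avoids [u]. The
    condition [a != b] excludes the degenerate path when [m = 0]. *)
Definition closed_paths m : nat :=
  (\sum_u \sum_(b in nbrs [set: G] u) \sum_(a in nbrs [set: G] u | a != b)
    npaths m ([set: G] :\ u) a b)%N.

Lemma closed_paths0 : closed_paths 0 = 0%N.
Proof.
do 2!rewrite /closed_paths big1 // => ? _.
by rewrite big1 // => a /andP[_ /negbTE/= ->].
Qed.

Lemma npaths_bound (R : realType) (d : R) m W a :
  (forall u : G, (degree u)%:R <= d) -> (\sum_b npaths m W a b)%N%:R <= d ^+ m.
Proof.
move=> dG; elim: m W a => [|m IHm] W a.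
  rewrite expr0 -[X in _ <= X]/(1%:R) ler_nat (bigD1 a) //= eqxx.
  by rewrite big1 // => b /negbTE; rewrite eq_sym => ->.
rewrite exchange_big /= natr_sum.
apply: (@le_trans _ _ (\sum_(c in nbrs (W :\ a) a) d ^+ m)); first exact: ler_sum.
have d0 : 0 <= d by apply: le_trans (dG a).
rewrite sumr_const -[leLHS]mulr_natl exprS ler_wpM2r ?exprn_ge0 //.
by apply: le_trans (dG a); rewrite ler_nat; exact: card_nbrs.
Qed.

Lemma closed_paths_bound (R : realType) (d : R) m :
  (forall u : G, (degree u)%:R <= d) ->
  (closed_paths m)%:R <= (nv G)%:R * d ^+ m.+1.
Proof.
move=> dG; rewrite /closed_paths natr_sum.
rewrite /nv mulr_natl -sumr_const; apply: ler_sum => u _.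
have d0 : 0 <= d by apply: le_trans (dG u).
apply: (@le_trans _ _ (\sum_(a in nbrs [set: G] u) d ^+ m)); last first.
  rewrite sumr_const -[leLHS]mulr_natl exprS ler_wpM2r ?exprn_ge0 //.
  by apply: le_trans (dG u); rewrite ler_nat; exact: card_nbrs.
apply: (@le_trans _ _ (\sum_(a in nbrs [set: G] u)
   (\sum_b npaths m ([set: G] :\ u) a b)%N%:R)); last first.
  by apply: ler_sum => a _; exact: npaths_bound.
rewrite -natr_sum ler_nat exchange_big /= big_mkcond /=; apply: leq_sum => b _.
case: ifP => // _; rewrite [leqRHS]big_mkcond [leqLHS]big_mkcond /=; apply: leq_sum => a _.
by case: (a \in _) => //=; case: ifP.
Qed.

Lemma big_tuple_cons (T : finType) m (F : m.+1.-tuple T -> nat) :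
  (\sum_t F t = \sum_x \sum_(t : m.-tuple T) F [tuple of x :: t])%N.
Proof.
rewrite pair_big (reindex (fun xt : T * m.-tuple T => [tuple of xt.1 :: xt.2])) //=.
exists (fun t => (thead t, [tuple of behead t])) => [[x t] _|t _] /=.
  by congr (_, _); apply: val_inj.
by rewrite -tuple_eta.
Qed.

(** The explicit form of the recursive count, used to send closed paths to
    embeddings of a cycle. *)
Lemma npathsE m W a b : npaths m W a b =
  (\sum_(t : m.-tuple G)
     [&& path (@edge G) a t, uniq (a :: t), all (mem W) t & last a t == b])%N.
Proof.
elim: m W a => [|m IHm] W a.
  rewrite (bigD1 [tuple]) //= big1 ?addn0 // => t.
  by rewrite tuple0.
rewrite npathsS big_tuple_cons big_mkcond; apply: eq_bigr => c _.
rewrite in_nbrs in_setD1; case: ifP => [/andP[/andP[ca cW] ac]|h].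
  rewrite IHm; apply: eq_bigr => t _ /=; rewrite ac cW /=; congr (nat_of_bool _).
  rewrite in_cons negb_or [a == c]eq_sym ca /=.
  have -> : all (mem (W :\ a)) t = (a \notin t) && all (mem W) t.
    apply/allP/andP => [h|[at_ /allP h] w wt].
      split; first by apply/negP => /h; rewrite /= !inE eqxx.
      by apply/allP => w /h; rewrite /= !inE => /andP[].
    have wW : w \in W := h w wt.
    rewrite /= in_setD1 wW andbT.
    by apply: contraNneq at_ => <-.
  case: (path _ _ _); case: (a \in t); case: (c \in t) => //=;
    by rewrite ?andbF.
rewrite big1 // => t _ /=.
case ac : (edge a c) => //=; case cW : (c \in W) => /=; last by rewrite !andbF.
move: h; rewrite ac cW !andbT => /negbFE/eqP->.
by rewrite inE eqxx andbF.
Qed.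


(** [next] on a duplicate-free tuple and [ordS] on its indices are the same
    cyclic successor. *)
Lemma cycle_tnth m (t : m.+2.-tuple G) (i : 'I_m.+2) :
  cycle (@edge G) t -> uniq t -> edge (tnth t i) (tnth t (ordS i)).
Proof.
move=> ct ut; suff -> : tnth t (ordS i) = next t (tnth t i).
  by apply: next_cycle => //; exact: mem_tnth.
rewrite next_nth mem_tnth.
(* At the last index next wraps around through the default value of nth. *)
case: t ct ut => -[|v s] //= st _ us; rewrite !(tnth_nth v).
rewrite -[if v == _ then _ else _]/(index (nth v (v :: s) i) (v :: s)).
have ss : size s = m.+1 by move/eqP: st => /= -[].
rewrite index_uniq //= ?ss //.
have := ltn_ord i; rewrite ltnS leq_eqVlt => /orP[/eqP im|im].
  by rewrite im modnn /= nth_default // ss.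
by rewrite modn_small.
Qed.

Lemma closed_paths_inj m : (closed_paths m <= Defs.inj (cycle_graph m.+2) G)%N.
Proof.
pose P (t : m.+2.-tuple G) := cycle (@edge G) t && uniq t.
apply: (@leq_trans #|[set t : m.+2.-tuple G | P t]|).
  rewrite -sum1_card big_mkcond /= big_tuple_cons; apply: leq_sum => u _.
  rewrite big_tuple_cons.
  pose F a b := (if [&& b \in nbrs [set: G] u, a \in nbrs [set: G] u & a != b]
                 then npaths m ([set: G] :\ u) a b else 0)%N.
  rewrite (_ : (\sum_(b in _) _ = \sum_b \sum_a F a b)%N); last first.
    rewrite big_mkcond; apply: eq_bigr => b _; rewrite /F.
    case: (b \in _) => /=; first by rewrite big_mkcond.
    by rewrite big1.
  rewrite exchange_big; apply: leq_sum => a _ /=.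
  rewrite (eq_bigr (fun b => (\sum_(t : m.-tuple G)
     [&& b \in nbrs [set: G] u, a \in nbrs [set: G] u, a != b,
         path (@edge G) a t, uniq (a :: t), all (mem ([set: G] :\ u)) t
       & last a t == b])%N)); last first.
    move=> b _; rewrite /F; case: ifP => [/and3P[-> -> ->]|h].
      by rewrite npathsE.
    by rewrite big1 // => t _; move: h; do 2![case: (_ \in nbrs _ _) => //=] => ->.
  rewrite exchange_big; apply: leq_sum => t _ /=.
  rewrite (bigD1 (last a t)) //= big1 ?addn0; last first.
    by move=> b /negbTE; rewrite eq_sym => ->; rewrite !andbF.
  have -> : [tuple of [:: u, a & t]] \in [set s : m.+2.-tuple G | P s] =
      P [tuple of [:: u, a & t]] by rewrite inE.
  rewrite /P /= rcons_path eqxx andbT.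
  case: and4P => // -[lN aN al /and3P[pt ut tu]].
  have ul : edge (last a t) u by move: lN; rewrite in_nbrs edge_sym => /andP[].
  have ua : edge u a by move: aN; rewrite in_nbrs => /andP[].
  rewrite ua pt ul /= in ut *; rewrite ut andbT.
  rewrite in_cons negb_or (contraTneq _ ua) /=; last by move=> ->; rewrite edge_irr.
  by case: (boolP (u \in t)) => // /(allP tu); rewrite /= !inE eqxx.
pose h (t : m.+2.-tuple G) : {ffun cycle_graph m.+2 -> G} := [ffun i => tnth t i].
have hi : injective h.
  by move=> t s /ffunP e; apply: eq_from_tnth => i; have := e i; rewrite !ffunE.
rewrite -(card_imset _ hi); apply: subset_leq_card.
apply/fintype.subsetP => _ /imsetP[t + ->]; rewrite inE => /andP[ct ut].
rewrite inE; apply/andP; split.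
  by apply/injectiveP => i j; rewrite !ffunE; move/tuple_uniqP: ut; apply.
apply/forallP => i; apply/forallP => j; rewrite !ffunE; apply/implyP.
case/andP=> _ /orP[]/eqP <-; first exact: cycle_tnth.
by rewrite edge_sym cycle_tnth.
Qed.

End CycleCount.

(** * Ratios of chromatic polynomials *)

Section RootedRatio.
Variables (R : realType) (G : sgraph) (z : R[i]).
Hypothesis z0 : z != 0.
Implicit Types (W B D : {set G}) (u b : G).

(** Normalised so that the leading term of the polynomial contributes 1. *)
Definition phi W B : R[i] := (map_poly intr (rpoly W B)).[z] / z ^+ #|W|.

Lemma phi_peel W B b : b \in B -> b \in W ->
  phi W B = phi W (B :\ b) - z^-1 * phi (W :\ b) (B :\ b :|: nbrs W b).
Proof.
move=> bB bW; rewrite /phi (rpoly_peel bB bW) rmorphB /= hornerD hornerN.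
rewrite (cardsD1 b W) bW add1n exprS invfM; ring.
Qed.

Lemma phi_root W u : u \in W -> phi W set0 = phi (W :\ u) (nbrs W u).
Proof.
move=> uW; rewrite /phi (rpoly_root uW) rmorphM /= hornerM.
rewrite map_polyX hornerX (cardsD1 u W) uW add1n exprS invfM.
by rewrite mulrACA divff // mul1r.
Qed.

Lemma phi_set0 : phi set0 set0 = 1.
Proof. by rewrite /phi rpoly_set0 rmorph1 hornerC cards0 expr0 divr1. Qed.

Lemma ch_phi : ch G z = z ^+ nv G * phi [set: G] set0.
Proof.
rewrite /phi rpoly_setT cardsT /ch /nv mulrCA divff ?mulr1 //.
exact: expf_neq0.
Qed.

Notation y := (cmod z^-1).
Notation p W := (cmod (phi W set0)).

Hypothesis small : forall u : G, (degree u)%:R * y <= 8^-1.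

Let y0 : 0 <= y. Proof. exact: cmod_ge0. Qed.
Let beta := 1 + 2 * y.
Let beta1 : 1 <= beta. Proof. by have := y0; rewrite /beta; lra. Qed.
Let beta0 : 0 <= beta. Proof. by have := y0; rewrite /beta; lra. Qed.

Lemma beta_nbrs b : beta ^+ degree b <= 4 / 3.
Proof. by apply: expr_1D_bound; [have := y0; lra|have := small b; lra]. Qed.

(** Peeling [b] enlarges the avoiding set by at most [degree b] nodes, at the
    price of the factor 4 / 3. *)
Lemma beta_cardU D W b : beta ^+ #|D :|: nbrs W b| <= beta ^+ #|D| * (4 / 3).
Proof.
apply: (@le_trans _ _ (beta ^+ (#|D| + degree b))).
  apply: ler_weXn2l => //; rewrite (leq_trans (leq_card_setU _ _)) //.
  by rewrite leq_add2l card_nbrs.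
by rewrite exprD ler_wpM2l ?exprn_ge0 // beta_nbrs.
Qed.


(** The induction hypothesis of the zero-freeness argument, for one set [W]
    and all [B]. *)
Let near W := forall B, B \subset W ->
  cmod (phi W B - phi W set0) <= (beta ^+ #|B| - 1) * p W.

(** By rooting, [phi W set0] is [phi (W :\ b)] with the neighbours of [b]
    avoiding [ord0], and [beta ^+ degree b - 1 <= 1 / 3]. *)
Lemma near_root W b : b \in W -> near (W :\ b) -> 2 / 3 * p (W :\ b) <= p W.
Proof.
move=> bW nW; have := nW _ (nbrs_sub W b); rewrite -phi_root // => hN.
have := cmod_le_dist (phi (W :\ b) set0) (phi W set0); rewrite cmod_subC.
have bN : beta ^+ #|nbrs W b| <= 4 / 3.
  by have := beta_cardU set0 W b; rewrite set0U cards0 expr0 mul1r.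
have := cmod_ge0 (phi (W :\ b) set0); nra.
Qed.

(** Bound on the second term of a peeling: 4 / 3 for the new avoiding nodes
    and 3 / 2 for the removal of [b] make 2, so the term costs
    [2 * y = beta - 1]. *)
Lemma near_step W D b : b \in W -> D \subset W :\ b -> near (W :\ b) ->
  y * cmod (phi (W :\ b) (D :|: nbrs W b)) <= 2 * y * beta ^+ #|D| * p W.
Proof.
move=> bW DW nW.
rewrite [leRHS](_ : _ = y * (2 * beta ^+ #|D| * p W)); last by ring.
rewrite ler_wpM2l //.
have UW : D :|: nbrs W b \subset W :\ b by rewrite subUset DW nbrs_sub.
have hU := nW _ UW; have hR := near_root bW nW.
have bU := beta_cardU D W b.
have t := cmod_le_dist (phi (W :\ b) (D :|: nbrs W b)) (phi (W :\ b) set0).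
have D1 : 1 <= beta ^+ #|D| by exact: exprn_ege1.
have pb0 := cmod_ge0 (phi (W :\ b) set0).
have q2 : cmod (phi (W :\ b) (D :|: nbrs W b)) <=
  4 / 3 * beta ^+ #|D| * p (W :\ b) by nra.
by apply: (le_trans q2); nra.
Qed.

(** One peeling adds [(beta - 1) * beta ^+ (#|B| - 1)] to the error
    [beta ^+ (#|B| - 1) - 1], which is exactly the increase to
    [beta ^+ #|B| - 1]. *)
Lemma phi_near W : near W.
Proof.
have [n] := ubnP #|W|; elim: n W => // n IHn W; rewrite ltnS => Wn B.
have [m] := ubnP #|B|; elim: m B => // m IHm B; rewrite ltnS => Bm BW.
have [->|[b bB]] := set_0Vmem B.
  by rewrite subrr cmod0 cards0 expr0 subrr mul0r.
have bW : b \in W by move/fintype.subsetP: BW; apply.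
have Wb : (#|W :\ b| < n)%N by move: Wn; rewrite (cardsD1 b W) bW.
have DW : B :\ b \subset W :\ b by apply: setSD.
have hB : cmod (phi W (B :\ b) - phi W set0) <= (beta ^+ #|B :\ b| - 1) * p W.
  apply: IHm; first by move: Bm; rewrite (cardsD1 b B) bB.
  exact: fintype.subset_trans (subD1set _ _) BW.
have st := near_step bW DW (IHn _ Wb).
rewrite (phi_peel bB bW) [in X in _ <= X](cardsD1 b B) bB add1n exprS.
rewrite addrAC; apply: (le_trans (cmodB _ _)); rewrite cmodM.
by rewrite /beta in hB st *; lra.
Qed.

Lemma phi_root_ge W b : b \in W -> 2 / 3 * p (W :\ b) <= p W.
Proof. by move=> bW; apply: near_root => //; exact: phi_near. Qed.

Lemma phi_step W D b : b \in W -> D \subset W :\ b ->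
  y * cmod (phi (W :\ b) (D :|: nbrs W b)) <= 2 * y * beta ^+ #|D| * p W.
Proof. by move=> bW DW; apply: near_step => //; exact: phi_near. Qed.

Lemma phi_gt0 W : 0 < p W.
Proof.
have [n] := ubnP #|W|; elim: n W => // n IHn W; rewrite ltnS => Wn.
have [->|[b bW]] := set_0Vmem W; first by rewrite phi_set0 cmod1.
apply: lt_le_trans (phi_root_ge bW).
by rewrite mulr_gt0 // IHn //; move: Wn; rewrite (cardsD1 b W) bW.
Qed.

Let k := 2 * y.
Let k0 : 0 <= k. Proof. by have := y0; rewrite /k; lra. Qed.

(** Self-avoiding paths in [W] have fewer than [#|W|] edges; truncating there
    instead of at a fixed length makes [pathsum_step] hold, as [W :\ a] has
    one node less. *)
Definition pathsum W a b : R := \sum_(m < #|W|) k ^+ m * (npaths m W a b)%:R.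

Lemma pathsum_ge0 W a b : 0 <= pathsum W a b.
Proof. by apply: sumr_ge0 => m _; rewrite mulr_ge0 ?exprn_ge0. Qed.

Lemma pathsum_diag W b : b \in W -> 1 <= pathsum W b b.
Proof.
move=> bW; rewrite /pathsum (cardsD1 b) bW add1n big_ord_recl /= eqxx mulr1.
by rewrite lerDl sumr_ge0 // => m _; rewrite mulr_ge0 ?exprn_ge0.
Qed.

Lemma pathsum_mono W W' a b : W \subset W' -> pathsum W a b <= pathsum W' a b.
Proof.
move=> WW'; have c := subset_leq_card WW'.
rewrite /pathsum -!(big_mkord xpredT (fun m => k ^+ m * (npaths m _ a b)%:R)).
rewrite [leRHS](big_cat_nat (leq0n _) c) /= -[leLHS]addr0; apply: lerD.
  by apply: ler_sum => m _; rewrite ler_wpM2l ?exprn_ge0 // ler_nat npaths_mono.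
by apply: sumr_ge0 => m _; rewrite mulr_ge0 ?exprn_ge0.
Qed.

(** Decomposition of a path by its first edge. *)
Lemma pathsum_step W a b : a \in W ->
  k * (\sum_(c in nbrs W a) pathsum (W :\ a) c b) <= pathsum W a b.
Proof.
move=> aW; rewrite [in leRHS]/pathsum (cardsD1 a) aW add1n big_ord_recl.
rewrite -[leLHS]add0r lerD ?mulr_ge0 ?exprn_ge0 //.
rewrite /pathsum exchange_big mulr_sumr /= ler_sum // => m _.
rewrite -mulr_sumr mulrA -exprS ler_wpM2l ?exprn_ge0 //.
rewrite -natr_sum ler_nat.
suff -> : nbrs W a = nbrs (W :\ a) a by [].
apply/setP => c; rewrite !in_nbrs in_setD1; case: eqVneq => //= ->.
by rewrite edge_irr andbF.
Qed.

Lemma pathsum_edge W a b : a \in W -> b \in W -> edge a b -> k <= pathsum W a b.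
Proof.
move=> aW bW ab; apply: le_trans (pathsum_step b aW).
rewrite -[leLHS]mulr1 ler_wpM2l //.
rewrite (bigD1 b) ?in_nbrs ?bW //= -[leLHS]addr0 lerD //; last first.
  by apply: sumr_ge0 => c _; exact: pathsum_ge0.
apply: pathsum_diag; rewrite !inE bW andbT.
by apply: contraTneq ab => ->; rewrite edge_irr.
Qed.

(** The right-hand function arises from the left-hand one by giving [b] colour
    [ord0]. For empty [D] they agree, by symmetry of the colours. Peeling
    [a] from [D] on both sides leaves the same comparison for [D :\ a] and,
    with a factor [z^-1], one in [W :\ a] started from the neighbours of [a]:
    this extends the paths by one edge. When [a] is adjacent to [b], its
    peeling has no counterpart on the right and the path ends at [b]. *)
Lemma phi_pin W D b : b \in W -> D \subset W :\ b ->
  cmod (phi W D - phi (W :\ b) (D :|: nbrs W b)) <=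
  beta ^+ #|D| * p W * \sum_(a in D) pathsum W a b.
Proof.
have [n] := ubnP #|W|; elim: n W D b => // n IHn W D b; rewrite ltnS => Wn bW.
have [m] := ubnP #|D|; elim: m D => // m IHm D; rewrite ltnS => Dm DW.
have [->|[a aD]] := set_0Vmem D.
  by rewrite set0U -phi_root // subrr cmod0 big_set0 mulr0.
have /setD1P[ab aW] : a \in W :\ b by move/fintype.subsetP: DW; apply.
have Wa : (#|W :\ a| < n)%N by move: Wn; rewrite (cardsD1 a W) aW.
have DaW : D :\ a \subset W :\ b := fintype.subset_trans (subD1set D a) DW.
have Dam : (#|D :\ a| < m)%N by move: Dm; rewrite (cardsD1 a D) aD.
have DWa : D :\ a \subset W :\ a.
  by apply: setSD; apply: fintype.subset_trans DW _; exact: subD1set.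
have baW : b \in W :\ a by rewrite !inE eq_sym ab.
have hD := IHm _ Dam DaW.
have b0 := beta0.
have p0 := cmod_ge0 (phi W set0).
have E0 : 0 <= beta ^+ #|D :\ a| by exact: exprn_ge0.
have S0 : 0 <= \sum_(c in D :\ a) pathsum W c b.
  by apply: sumr_ge0 => c _; exact: pathsum_ge0.
have kk := k0.
rewrite (phi_peel aD aW) (big_setD1 a aD) /= (cardsD1 a D) aD add1n exprS.
(* If a is adjacent to b, the pinned b already forces a to avoid ord0. *)
have [eab|nab] := boolP (edge b a).
  have -> : D :|: nbrs W b = D :\ a :|: nbrs W b.
    apply/setP => c; rewrite !inE; case: eqVneq => //= ->.
    by rewrite aW eab orbT.
  rewrite addrAC; apply: (le_trans (cmodB _ _)); rewrite cmodM.
  have hs := phi_step aW DWa.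
  have he : k <= pathsum W a b by apply: pathsum_edge => //; rewrite edge_sym.
  have : beta ^+ #|D :\ a| * p W * k <= beta ^+ #|D :\ a| * p W * pathsum W a b.
    by rewrite ler_wpM2l // mulr_ge0.
  move: hD hs; set X := beta ^+ #|D :\ a| * p W.
  have X0 : 0 <= X by rewrite mulr_ge0.
  rewrite -[2 * y * _ * _]mulrA -/X -/k -[beta * _ * _]mulrA -/X /beta -/k.
  set P := pathsum W a b; have P0 : 0 <= P by exact: pathsum_ge0.
  set S := \sum_(c in _) _ in S0 *.
  have := mulr_ge0 (mulr_ge0 kk X0) (addr_ge0 P0 S0).
  move=> *; nra.
(* Otherwise a can be peeled in both terms, and the two peeled terms are again
   compared by pinning b. *)
have e1 : phi (W :\ b) (D :|: nbrs W b) = phi (W :\ b) (D :\ a :|: nbrs W b) -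
    z^-1 * phi ((W :\ a) :\ b) ((D :\ a :|: nbrs W a) :|: nbrs (W :\ a) b).
  rewrite (@phi_peel _ _ a) ?inE ?aD ?ab ?aW //; congr (phi _ _ - _ * phi _ _).
  - apply/setP => c; rewrite !inE; case: eqVneq => //= ->.
    by rewrite (negbTE nab) andbF.
  - by rewrite !setDDl setUC.
  - apply/setP => c; rewrite !inE; case: (eqVneq c a) => [->|] //=.
      by rewrite edge_irr !andbF.
    case: (eqVneq c b) => [->|] //=.
      by rewrite edge_sym (negbTE nab) edge_irr !andbF !orbF.
    by rewrite orbAC.
rewrite e1.
have -> : phi W (D :\ a) - z^-1 * phi (W :\ a) (D :\ a :|: nbrs W a) -
  (phi (W :\ b) (D :\ a :|: nbrs W b) -
    z^-1 * phi ((W :\ a) :\ b) (D :\ a :|: nbrs W a :|: nbrs (W :\ a) b)) =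
  (phi W (D :\ a) - phi (W :\ b) (D :\ a :|: nbrs W b)) -
  z^-1 * (phi (W :\ a) (D :\ a :|: nbrs W a) -
   phi ((W :\ a) :\ b) ((D :\ a :|: nbrs W a) :|: nbrs (W :\ a) b)) by ring.
apply: (le_trans (cmodB _ _)); rewrite cmodM.
have UW : D :\ a :|: nbrs W a \subset (W :\ a) :\ b.
  rewrite subUset; apply/andP; split; apply/fintype.subsetP => c.
    rewrite !inE => /andP[ca cD]; rewrite ca /=.
    by move/fintype.subsetP: DW => /(_ c cD); rewrite !inE.
  rewrite !inE => /andP[cW ac]; rewrite cW andbT; apply/andP; split.
    by apply: contraNneq nab => <-; rewrite edge_sym.
  by apply: contraTneq ac => ->; rewrite edge_irr.
have hr := IHn _ _ _ Wa baW UW.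
have rg := phi_root_ge aW.
have bU := beta_cardU (D :\ a) W a.
have sU : \sum_(c in D :\ a :|: nbrs W a) pathsum (W :\ a) c b <=
    \sum_(c in D :\ a) pathsum W c b + \sum_(c in nbrs W a) pathsum (W :\ a) c b.
  apply: (@le_trans _ _ (\sum_(c in D :\ a) pathsum (W :\ a) c b +
      \sum_(c in nbrs W a) pathsum (W :\ a) c b)); last first.
    by rewrite lerD2r; apply: ler_sum => c _; rewrite pathsum_mono ?subD1set.
  rewrite (big_setID (D :\ a)) /= setUK lerD2l.
  rewrite [leRHS](big_setID (D :\ a)) /= setDUl setDv set0U lerDr.
  by apply: sumr_ge0 => c _; exact: pathsum_ge0.
have ps := pathsum_step b aW.
have U0 : 0 <= \sum_(c in D :\ a :|: nbrs W a) pathsum (W :\ a) c b.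
  by apply: sumr_ge0 => c _; exact: pathsum_ge0.
move: hD hr bU sU ps S0 U0 E0.
set E := beta ^+ #|D :\ a|; set F := beta ^+ #|D :\ a :|: nbrs W a|.
set S := \sum_(c in D :\ a) pathsum W c b.
set T := \sum_(c in D :\ a :|: nbrs W a) _; set N := \sum_(c in nbrs W a) _.
set X := cmod (phi W (D :\ a) - _); set Y := cmod (phi (W :\ a) _ - _).
move=> hX hY bU sU ps S0 U0 E0.
have pa0 := cmod_ge0 (phi (W :\ a) set0).
have yy := y0.
have h1 : F * p (W :\ a) <= E * (2 * p W).
  apply: (@le_trans _ _ (E * (4 / 3) * p (W :\ a))); first by rewrite ler_wpM2r.
  by rewrite -mulrA ler_wpM2l //; lra.
have h2 : Y <= E * (2 * p W) * (S + N).
  apply: (le_trans hY); apply: ler_pM => //.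
  by rewrite mulr_ge0 // exprn_ge0.
have h3 : y * Y <= y * (E * (2 * p W) * (S + N)) by rewrite ler_wpM2l.
have h4 : E * p W * (k * N) <= E * p W * pathsum W a b.
  by rewrite ler_wpM2l // mulr_ge0.
have P0 : 0 <= pathsum W a b by exact: pathsum_ge0.
have h5 : 0 <= k * (E * p W) * pathsum W a b by rewrite !mulr_ge0.
apply: (le_trans (lerD hX h3)).
by rewrite /beta -/k; rewrite /k in h4 h5 *; lra.
Qed.

(** Each [b] in [B] contributes the factor [1 - z^-1], up to the influence of
    the other nodes of [B] on [b] that [phi_pin] controls. *)
Lemma phi_forest W B : B \subset W ->
  cmod (phi W B - (1 - z^-1) ^+ #|B| * phi W set0) <=
  y * beta ^+ #|B| * p W * \sum_(b in B) \sum_(a in B | a != b) pathsum W a b.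
Proof.
have [m] := ubnP #|B|; elim: m B => // m IHm B; rewrite ltnS => Bm BW.
have [->|[b bB]] := set_0Vmem B.
  by rewrite cards0 expr0 mul1r subrr cmod0 big_set0 mulr0.
have bW : b \in W by move/fintype.subsetP: BW; apply.
have DW : B :\ b \subset W :\ b by apply: setSD.
have hB : (#|B :\ b| < m)%N by move: Bm; rewrite (cardsD1 b B) bB.
have {}hB := IHm _ hB (fintype.subset_trans (subD1set _ _) BW).
have hf := phi_pin bW DW.
rewrite (cardsD1 b B) bB add1n !exprS.
have -> : phi W B - (1 - z^-1) * (1 - z^-1) ^+ #|B :\ b| * phi W set0 =
  (1 - z^-1) * (phi W (B :\ b) - (1 - z^-1) ^+ #|B :\ b| * phi W set0) +
  z^-1 * (phi W (B :\ b) - phi (W :\ b) (B :\ b :|: nbrs W b)).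
  by rewrite (phi_peel bB bW); ring.
apply: (le_trans (cmodD _ _)).
rewrite [cmod ((1 - _) * _)]cmodM [cmod (z^-1 * _)]cmodM.
have c1 : cmod (1 - z^-1) <= 1 + y by rewrite -[in leRHS](@cmod1 R); exact: cmodB.
have yy := y0.
have sB : \sum_(c in B :\ b) \sum_(a in B :\ b | a != c) pathsum W a c +
    \sum_(a in B :\ b) pathsum W a b <=
    \sum_(c in B) \sum_(a in B | a != c) pathsum W a c.
  rewrite addrC (big_setD1 b bB) /=; apply: lerD.
    rewrite le_eqVlt; apply/orP; left; apply/eqP; apply: eq_bigl => a.
    by rewrite !inE andbC.
  apply: ler_sum => c _.
  rewrite big_mkcond [leRHS]big_mkcond; apply: ler_sum => a _.
  rewrite !inE; case: (a \in B); rewrite ?andbF //=.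
  by do 2?case: eqVneq => //= _; exact: pathsum_ge0.
have E0 : 0 <= beta ^+ #|B :\ b| by have := beta0; exact: exprn_ge0.
have p0 := cmod_ge0 (phi W set0).
have S0 : 0 <= \sum_(c in B :\ b) \sum_(a in B :\ b | a != c) pathsum W a c.
  by do 2!apply: sumr_ge0 => ? _; exact: pathsum_ge0.
have T0 : 0 <= \sum_(a in B :\ b) pathsum W a b.
  by apply: sumr_ge0 => ? _; exact: pathsum_ge0.
move: hB hf sB S0 T0 E0.
set E := beta ^+ #|B :\ b|; set X := cmod _; set Y := cmod (phi W _ - phi _ _).
set S := \sum_(c in B :\ b) _; set T := \sum_(a in B :\ b) _.
set U := \sum_(c in B) _; move=> hX hY hU S0 T0 E0.
have X0 : 0 <= X by exact: cmod_ge0.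
have h1 : cmod (1 - z^-1) * X <= (1 + y) * (y * E * p W * S).
  by apply: ler_pM => //; exact: cmod_ge0.
have h2 : y * Y <= y * (E * p W * T) by rewrite ler_wpM2l.
apply: (le_trans (lerD h1 h2)).
apply: (@le_trans _ _ (y * (beta * E) * p W * (S + T))); last first.
  by rewrite ler_wpM2l // !mulr_ge0 // beta0.
have V0 : 0 <= y * E * p W by rewrite !mulr_ge0.
have := mulr_ge0 yy (mulr_ge0 V0 S0); have := mulr_ge0 yy (mulr_ge0 V0 T0).
rewrite /beta; lra.
Qed.

End RootedRatio.

(** * Logarithm of the chromatic polynomial *)

Section LogRatio.
Variables (R : realType) (G : sgraph).
Implicit Types (W B D : {set G}) (u b : G).

Variable z : R[i].
Hypothesis z0 : z != 0.
Notation y := (cmod z^-1).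
Hypothesis y8 : y <= 8^-1.
Hypothesis small : forall u : G, (degree u)%:R * y <= 8^-1.
Notation p W := (cmod (phi z W set0)).

(** Weighted count of the cycles through [u], as paths between pairs of
    distinct neighbours of [u]. *)
Definition forks W u : R :=
  \sum_(b in nbrs W u) \sum_(a in nbrs W u | a != b) pathsum z (W :\ u) a b.

Lemma cmod_1Bz_gt0 : 0 < cmod (1 - z^-1).
Proof.
have := cmod_le_dist 1 z^-1; rewrite cmod1.
by have := y8; lra.
Qed.

Lemma cmod_1Bz_exp n : n%:R * y <= 8^-1 -> 2 / 3 <= cmod (1 - z^-1) ^+ n.
Proof.
move=> ny; suff : 1 - n%:R * y <= cmod (1 - z^-1) ^+ n by move=> ?; lra.
have c0 := cmod_1Bz_gt0.
have c1 : 1 - y <= cmod (1 - z^-1).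
  by have := cmod_le_dist 1 z^-1; rewrite cmod1; lra.
have yy : 0 <= y by exact: cmod_ge0.
have y8' := y8.
elim: n ny => [|n IHn]; first by rewrite expr0; lra.
rewrite -addn1 natrD addn1 exprS => ny.
have nn : 0 <= n%:R * y :> R by exact: mulr_ge0.
have {}IHn := IHn ltac:(lra).
apply: (@le_trans _ _ ((1 - y) * (1 - n%:R * y))); first nra.
by apply: ler_pM => //; lra.
Qed.

(** Both [p W] and its prediction are at least 2 / 3 of [p (W :\ u)], where
    [ln] has slope at most 3 / 2 in relative terms; with the 4 / 3 from
    [beta ^+ degree u] this makes the constant 2. *)
Lemma ln_phi_root W u : u \in W ->
  `|ln (p W) - (ln (p (W :\ u)) + #|nbrs W u|%:R * ln (cmod (1 - z^-1)))|
  <= 2 * y * forks W u.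
Proof.
move=> uW; set n := #|nbrs W u|.
have P0 : 0 < p (W :\ u) by exact: phi_gt0.
have yy : 0 <= y by exact: cmod_ge0.
have c0 := cmod_1Bz_gt0.
have nd : n%:R * y <= 8^-1.
  apply: le_trans (small u); rewrite ler_wpM2r // ler_nat; exact: card_nbrs.
have cn := cmod_1Bz_exp nd.
have -> : ln (p (W :\ u)) + n%:R * ln (cmod (1 - z^-1)) =
    ln (cmod (1 - z^-1) ^+ n * p (W :\ u)).
  by rewrite lnM ?posrE ?exprn_gt0 // lnXn // addrC mulr_natl.
have h := phi_forest z0 small (nbrs_sub W u); rewrite -phi_root // in h.
have h1 := phi_root_ge z0 small uW.
have F0 : 0 <= forks W u.
  by do 2!apply: sumr_ge0 => ? _; exact: pathsum_ge0.
have b1 : (1 + 2 * y) ^+ n <= 4 / 3 by apply: expr_1D_bound; lra.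
apply: (@le_trans _ _ (`|p W - cmod (1 - z^-1) ^+ n * p (W :\ u)| /
                         (2 / 3 * p (W :\ u)))).
  by apply: ln_dist; rewrite ?ler_wpM2r ?mulr_gt0 // ltW.
rewrite ler_pdivrMr ?mulr_gt0 //.
have h2 : `|p W - cmod (1 - z^-1) ^+ n * p (W :\ u)| <=
    cmod (phi z W set0 - (1 - z^-1) ^+ n * phi z (W :\ u) set0).
  rewrite -cmodX -cmodM; set X := phi z W set0; set Y := _ ^+ n * _.
  have := cmod_le_dist X Y; have := cmod_le_dist Y X.
  by rewrite (cmod_subC Y X) ler_norml => *; apply/andP; split; lra.
apply: (le_trans h2); apply: (le_trans h).
rewrite -/(forks W u) -/n.
have : 0 <= y * forks W u * p (W :\ u) by rewrite !mulr_ge0 // ltW.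
set V := y * _ * _ => V0; have := ler_wpM2r V0 b1; rewrite /V; lra.
Qed.

Lemma forks_mono W W' u : W \subset W' -> forks W u <= forks W' u.
Proof.
move=> S; have N := fintype.subsetP (nbrs_mono u S).
rewrite /forks big_mkcond [leRHS]big_mkcond; apply: ler_sum => b _.
case: ifP => [bN|_]; last first.
  by case: ifP => // _; apply: sumr_ge0 => a _; exact: pathsum_ge0.
rewrite N // big_mkcond [leRHS]big_mkcond; apply: ler_sum => a _.
case: ifP => [/andP[aN ->]|_]; last by case: ifP => // _; exact: pathsum_ge0.
by rewrite N //=; apply: pathsum_mono; exact: setSD.
Qed.

(** Eliminating the nodes of [W] one by one meets each edge of [W] exactly
    once. *)
Lemma ln_phi W :
  `|ln (p W) - #|edges_in W|%:R * ln (cmod (1 - z^-1))|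
  <= 2 * y * \sum_(u in W) forks [set: G] u.
Proof.
have yy : 0 <= y by exact: cmod_ge0.
have [n] := ubnP #|W|; elim: n W => // n IHn W; rewrite ltnS => Wn.
have [->|[u uW]] := set_0Vmem W.
  rewrite big_set0 mulr0 phi_set0 cmod1 ln1 sub0r normrN.
  rewrite (_ : edges_in _ = set0) ?cards0 ?mul0r ?normr0 //.
  apply/setP => A; rewrite !inE subset0; apply/negbTE/negP => /andP[].
  case/existsP => v /existsP[w /andP[_ /eqP->]] /eqP/setP/(_ v).
  by rewrite !inE eqxx.
have hW : (#|W :\ u| < n)%N by move: Wn; rewrite (cardsD1 u W) uW.
have h1 := IHn _ hW; have h2 := ln_phi_root uW.
have h3 := forks_mono u (subsetT W).
rewrite (big_setD1 u uW) /= (edges_in_root uW) natrD.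
set A := ln _ in h2 *; set B := ln (p (W :\ u)) in h1 h2 *.
set L := ln (cmod _) in h1 h2 *.
set f := forks W u in h2 h3; set g := forks _ u in h3 *.
set S := \sum_(_ in _) _ in h1 *.
have {}h3 : 2 * y * f <= 2 * y * g by rewrite ler_wpM2l // mulr_ge0.
have -> : A - (#|edges_in (W :\ u)|%:R + #|nbrs W u|%:R) * L =
  (A - (B + #|nbrs W u|%:R * L)) + (B - #|edges_in (W :\ u)|%:R * L) by ring.
apply: (le_trans (ler_normD _ _)); lra.
Qed.

End LogRatio.

(** * Passage to the limit *)

(** Extending every sum over path lengths to [nv G] allows the sums over
    nodes and lengths to be exchanged. *)
Lemma forks_cycles (R : realType) (G : sgraph) (z : R[i]) :
  2 * cmod z^-1 * \sum_(u in [set: G]) forks z [set: G] u <=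
  \sum_(m < nv G) (2 * cmod z^-1) ^+ m.+1 * (closed_paths G m)%:R.
Proof.
set k := 2 * _; have k0 : 0 <= k by rewrite mulr_ge0 ?cmod_ge0.
have -> : \sum_(m < nv G) k ^+ m.+1 * (closed_paths G m)%:R =
  k * \sum_u \sum_(b in nbrs [set: G] u) \sum_(a in nbrs [set: G] u | a != b)
      \sum_(m < nv G) k ^+ m * (npaths m ([set: G] :\ u) a b)%:R.
  rewrite mulr_sumr; under [in RHS]eq_bigr => u _.
    rewrite mulr_sumr; under eq_bigr => b _.
      rewrite mulr_sumr; under eq_bigr => a _ do rewrite mulr_sumr.
      rewrite exchange_big; over.
    rewrite exchange_big; over.
  rewrite exchange_big; apply: eq_bigr => m _; rewrite natr_sum mulr_sumr.
  apply: eq_bigr => u _; rewrite natr_sum mulr_sumr; apply: eq_bigr => b _.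
  by rewrite natr_sum mulr_sumr; apply: eq_bigr => a _; rewrite exprS mulrA.
rewrite ler_wpM2l // (eq_bigl xpredT); last by move=> u; rewrite inE.
apply: ler_sum => u _; rewrite /forks.
apply: ler_sum => b _; apply: ler_sum => a _.
have c : (#|[set: G] :\ u| <= nv G)%N by rewrite max_card.
rewrite /pathsum -!(big_mkord xpredT (fun m => k ^+ m * (npaths m _ a b)%:R)).
rewrite [leRHS](big_cat_nat (leq0n _) c) /= lerDl.
by apply: sumr_ge0 => m _; rewrite mulr_ge0 ?exprn_ge0.
Qed.

(** With [r = Re xi^-1], the squared modulus is [1 + w] where
    [d * w] tends to [- 2 r], and [w / (1 + w) <= ln (1 + w) <= w]. *)
Lemma cvg_edge_factor (R : realType) (d : nat -> R) (xi : R[i]) :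
  xi != 0 -> (d n @[n --> \oo] --> +oo)%classic ->
  (d n * ln (cmod (1 - (xi * real_complex R (d n))^-1)) @[n --> \oo]
    --> - complex.Re xi^-1)%classic.
Proof.
move=> xi0 dy.
pose r := complex.Re xi^-1; pose rho := cmod xi^-1.
(* |1 - 1/z|^2 = 1 - 2 Re(1/z) + |1/z|^2. *)
pose w n := - (2 * r) * (d n)^-1 + rho ^+ 2 * (d n)^-1 ^+ 2.
have d1 : (\forall n \near \oo, 1 <= d n)%classic by exact: cvgry_ge.
have i0 : ((d n)^-1 @[n --> \oo] --> (0 : R))%classic.
  apply/gtr0_cvgV0; last exact: dy.
  by near=> n; apply: lt_le_trans ltr01 _; near: n.
have w0 : (w n @[n --> \oo] --> (0 : R))%classic.
  rewrite (_ : 0 = - (2 * r) * 0 + rho ^+ 2 * 0 ^+ 2); last by ring.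
  apply: cvgD; first by apply: cvgM => //; exact: cvg_cst.
  apply: cvgM; first exact: cvg_cst.
  by rewrite expr2; under eq_fun do rewrite expr2; exact: cvgM.
have dw : (- (2 * r) + rho ^+ 2 * (d n)^-1 @[n --> \oo] --> - (2 * r))%classic.
  have h : (- (2 * r) + rho ^+ 2 * (d n)^-1 @[n --> \oo]
      --> - (2 * r) + rho ^+ 2 * 0)%classic.
    by apply: cvgD; [exact: cvg_cst|apply: cvgM => //; exact: cvg_cst].
  by rewrite mulr0 addr0 in h.
have wE n : 1 <= d n ->
    cmod (1 - (xi * real_complex R (d n))^-1) ^+ 2 = 1 + w n.
  move=> dn; rewrite cmod_sqr_1B invfM -fmorphV Re_mul_real cmodM.
  rewrite cmod_real ?invr_ge0; last by lra.
  by rewrite /w /r /rho; ring.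
have wd n : 1 <= d n -> d n * w n = - (2 * r) + rho ^+ 2 * (d n)^-1.
  by move=> dn; rewrite /w; field; rewrite gt_eqF //; lra.
have lnE n : 1 <= d n -> -1 < w n ->
    ln (cmod (1 - (xi * real_complex R (d n))^-1)) = 2^-1 * ln (1 + w n).
  move=> dn wn; rewrite -wE // lnXn; first by rewrite -[ln _ *+ 2]mulr_natl mulKf // pnatr_eq0.
  rewrite lt_neqAle cmod_ge0 andbT eq_sym; apply/eqP => c0.
  by move: wn; rewrite -subr_gt0 opprK addrC -wE // c0 expr0n ltxx.
have w1 : (\forall n \near \oo, -1 < w n)%classic.
  by apply: (cvgr_gt _ w0); lra.
rewrite (_ : - complex.Re xi^-1 = 2^-1 * - (2 * r)); last by rewrite /r; lra.
apply: (@squeeze_cvgr _ _ _ _ (fun n => 2^-1 * ((- (2 * r) + rho ^+ 2 * (d n)^-1) / (1 + w n)))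
  (fun n => 2^-1 * (- (2 * r) + rho ^+ 2 * (d n)^-1))).
- near=> n.
  have dn : 1 <= d n by near: n.
  have wn : -1 < w n by near: n.
  rewrite lnE // -wd // [d n * (2^-1 * _)]mulrCA; apply/andP; split; rewrite ler_wpM2l //.
    by rewrite -mulrA ler_wpM2l ?ln1D_ge //; lra.
  by rewrite ler_wpM2l ?le_ln1Dx //; lra.
- apply: cvgM; first exact: cvg_cst.
  have h : ((- (2 * r) + rho ^+ 2 * (d n)^-1) / (1 + w n) @[n --> \oo]
      --> - (2 * r) / (1 + 0))%classic.
    apply: cvgM => //; apply: cvgV; first by rewrite addr0 oner_eq0.
    by apply: cvgD => //; exact: cvg_cst.
  by rewrite addr0 divr1 in h.
- by apply: cvgM => //; exact: cvg_cst.
Unshelve. all: by end_near.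
Qed.

Lemma root_ch (R : realType) (G : sgraph) (z : R[i]) :
  (0 < nv G)%N -> z != 0 -> 0 < cmod (phi z [set: G] set0) ->
  cmod (ch G z) `^ (nv G)%:R^-1 / cmod z =
  expR ((nv G)%:R^-1 * ln (cmod (phi z [set: G] set0))).
Proof.
move=> v0 z0 p0; rewrite (ch_phi G z0) cmodM cmodX.
have c0 : 0 < cmod z by rewrite lt_neqAle cmod_ge0 andbT eq_sym cmod_eq0.
rewrite /powR gt_eqF ?mulr_gt0 ?exprn_gt0 // lnM ?posrE ?exprn_gt0 //.
rewrite lnXn // mulrDr -[ln (cmod z) *+ _]mulr_natl mulKf ?pnatr_eq0 -?lt0n //.
by rewrite expRD lnK ?posrE // mulrAC divff ?mul1r // gt_eqF.
Qed.

Local Open Scope classical_set_scope.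

Theorem theorem3p2 (R : realType) (G : nat -> sgraph) (d : nat -> R)
    (tK2 : R) (xi : R[i]) :
  (forall n, (0 < nv (G n))%N) ->
  (forall n, admissible (G n) (d n)) ->
  large_essential_girth G d ->
  (d n @[n --> \oo] --> +oo) ->
  ((2 * (ne (G n))%:R / ((nv (G n))%:R * d n)) @[n --> \oo] --> tK2) ->
  8 <= cmod xi ->
  ((cmod (ch (G n) (xi * real_complex R (d n))) `^ ((nv (G n))%:R^-1)
      / (cmod xi * d n)) @[n --> \oo]
    --> expR (- tK2 * complex.Re (1 / (2 * xi)))).
Proof.
move=> v0 adm girth dy tK xi8.
have xi0 : xi != 0 by rewrite -cmod_eq0 gt_eqF //; lra.
pose z n := xi * real_complex R (d n).
have d1 n : 1 <= d n by case: (adm n).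
have dG n u : (degree (u : G n))%:R <= d n by case: (adm n).
have zE n : cmod (z n) = cmod xi * d n.
  by rewrite cmodM cmod_real // (le_trans ler01).
have z0 n : z n != 0.
  by rewrite -cmod_eq0 zE mulf_neq0 // gt_eqF //; have := d1 n; lra.
have yd n : d n * cmod (z n)^-1 <= 8^-1.
  rewrite cmodV zE invfM mulrCA divff ?mulr1; last by rewrite gt_eqF //; have := d1 n; lra.
  by rewrite lef_pV2 // posrE; lra.
have y0 n : 0 <= cmod (z n)^-1 by exact: cmod_ge0.
have small n (u : G n) : (degree u)%:R * cmod (z n)^-1 <= 8^-1.
  by apply: le_trans (yd n); rewrite ler_wpM2r.
have y8 n : cmod (z n)^-1 <= 8^-1.
  by apply: le_trans (yd n); rewrite -[leLHS]mul1r ler_wpM2r.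
pose P n := cmod (phi (z n) [set: G n]%SET finset.set0).
have P0 n : 0 < P n by exact: phi_gt0.
pose L n := ln (cmod (1 - (z n)^-1)).
pose c n m := (2 * cmod (z n)^-1) ^+ m.+1 * (closed_paths (G n) m)%:R / (nv (G n))%:R.
have vr n : 0 < (nv (G n))%:R :> R by rewrite ltr0n.
have k0 n : 0 <= 2 * cmod (z n)^-1 by rewrite mulr_ge0.
have kd n : 2 * cmod (z n)^-1 * d n <= 4^-1 by have := yd n; lra.
have c01 n m : 0 <= c n m <= 4^-1 ^+ m.
  rewrite /c !mulr_ge0 ?exprn_ge0 //= ler_pdivrMr //.
  apply: (@le_trans _ _ ((2 * cmod (z n)^-1) ^+ m.+1 * ((nv (G n))%:R * d n ^+ m.+1))).
    by rewrite ler_wpM2l ?exprn_ge0 // closed_paths_bound.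
  rewrite mulrCA mulrC ler_wpM2r // -exprMn exprS -[leRHS]mul1r.
  have kd0 : 0 <= 2 * cmod (z n)^-1 * d n by rewrite mulr_ge0 // (le_trans ler01).
  have := kd n => kd4.
  apply: ler_pM; rewrite ?exprn_ge0 //; first lra.
  by rewrite lerXn2r // nnegrE; lra.
have c0 m : (c n m @[n --> \oo] --> (0 : R)).
  case: m => [|m].
    rewrite (_ : (fun n => c n 0%N) = fun=> 0); first exact: cvg_cst.
    by apply/funext => n; rewrite /c closed_paths0 mulr0 mul0r.
  have d2 : \forall n \near \oo, 2 <= d n by exact: cvgry_ge.
  apply: (@squeeze_cvgr _ _ _ _ (fun=> 0)
    (fun n => t_inj (cycle_graph m.+3) (G n) (d n))); last 2 first.
  - exact: cvg_cst.
  - exact: girth.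
  near=> n; have [-> _] := andP (c01 n m.+1).
  have dn : 2 <= d n by near: n.
  have nvE : nv (cycle_graph m.+3) = m.+3 by rewrite /nv card_ord.
  rewrite /= /t_inj /c nvE !subSS subn0.
  have dd : 0 < (nv (G n))%:R * d n * (d n - 1) ^+ m.+1.
    by rewrite !mulr_gt0 // ?exprn_gt0 //; lra.
  have hi : (closed_paths (G n) m.+1)%:R <= (Defs.inj (cycle_graph m.+3) (G n))%:R :> R.
    by rewrite ler_nat closed_paths_inj.
  have kdd : (2 * cmod (z n)^-1) ^+ m.+2 * (d n * (d n - 1) ^+ m.+1) <= 1.
    apply: (@le_trans _ _ ((2 * cmod (z n)^-1) ^+ m.+2 * d n ^+ m.+2)).
      rewrite ler_wpM2l ?exprn_ge0 // [in leRHS]exprS ler_wpM2l //; first lra.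
      by rewrite lerXn2r // ?nnegrE; lra.
    rewrite -exprMn exprn_ile1 //; first by rewrite mulr_ge0 //; lra.
    by have := kd n; lra.
  rewrite ler_pdivlMr //.
  rewrite [leLHS](_ : _ = (2 * cmod (z n)^-1) ^+ m.+2 * (d n * (d n - 1) ^+ m.+1)
    * (closed_paths (G n) m.+1)%:R); last by field; rewrite gt_eqF.
  rewrite -[leRHS]mul1r ler_pM //; apply: mulr_ge0; first exact: exprn_ge0.
  by apply: mulr_ge0; [lra|apply: exprn_ge0; lra].
have err0 : ((nv (G n))%:R^-1 * (ln (P n) - (ne (G n))%:R * L n) @[n --> \oo] --> (0 : R)).
  apply/cvgr0Pnorm_lt => e e0.
  have := tannery0 (fun n => nv (G n)) c01 c0.
  move=> /cvgr0Pnorm_lt /(_ e e0); apply: filterS => n; apply: le_lt_trans.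
  rewrite normrM ger0_norm ?invr_ge0 //; apply: le_trans (ler_norm _).
  rewrite /c -mulr_suml mulrC ler_wpM2r ?invr_ge0 //.
  apply: le_trans (forks_cycles (G n) (z n)).
  by have := ln_phi (z0 n) (y8 n) (@small n) [set: G n]%SET; rewrite edges_inT.
have edge_lim : (2 * (ne (G n))%:R / ((nv (G n))%:R * d n)) * (2^-1 * (d n * L n))
   @[n --> \oo] --> tK2 * (2^-1 * - complex.Re xi^-1).
  apply: cvgM => //; apply: cvgM; first exact: cvg_cst.
  exact: cvg_edge_factor.
have -> : - tK2 * complex.Re (1 / (2 * xi)) = 0 + tK2 * (2^-1 * - complex.Re xi^-1).
  have -> : 1 / (2 * xi) = xi^-1 * real_complex R 2^-1.
    by rewrite div1r invfM mulrC fmorphV rmorph_nat.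
  by rewrite Re_mul_real; lra.
under eq_fun => n do rewrite -zE (root_ch (v0 n) (z0 n) (P0 n)).
apply: continuous_cvg; first exact: continuous_expR.
rewrite (_ : (fun n => _) = (fun n =>
  (nv (G n))%:R^-1 * (ln (P n) - (ne (G n))%:R * L n) +
  (2 * (ne (G n))%:R / ((nv (G n))%:R * d n)) * (2^-1 * (d n * L n)))).
  exact: cvgD err0 edge_lim.
apply/funext => n; rewrite -/(P n); field.
by rewrite !gt_eqF //; have := d1 n; lra.
Unshelve. all: by end_near.
Qed.
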